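(* Let $n\geq 3$ and let $1,2,\ldots,s_{\delta(n)},s_{\delta(n)+1}=n$ be an addition chain producing $n$ of length $\delta(n)$, with associated generators $2=a_2+r_2$, $s_3=a_3+r_3,\ldots,s_{\delta(n)+1}=a_{\delta(n)+1}+r_{\delta(n)+1}=n$, where $a_2=r_2=1$ and $a_{i+1}=a_i+r_i$ for $2\leq i\leq \delta(n)$. Then \[\sum_{j=2}^{\delta(n)+1} a_j=(n-1)+(\delta(n)-1)+a_{\delta(n)}-r_{\delta(n)+1}+\int_{2}^{\delta(n)-1}\sum_{2\leq j\leq t} r_j\,dt.\]
   Context: An addition chain of length $k-1$ producing $n$ is a sequence $1=s_1,2=s_2,\ldots,s_{k-1},s_k=n$ in which each term $s_j$ ($j\geq 3$) is the sum of two earlier terms. In this paper each term is written via a partition $s_i=a_i+r_i$ ($2\leq i\leq k$), called the $i$-th generator, with $2=1+1$ (i.e. $a_2=r_2=1$) and $a_{i+1}=a_i+r_i$; $a_i$ is the determiner and $r_i$ the regulator of the $i$-th generator. Here $k-1=\delta(n)$. The integrand $t\mapsto\sum_{2\leq j\leq t}r_j$ is the step function of the real variable $t$ summing the regulators with integer index $j$ satisfying $2\leq j\leq t$. *)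

(* Defs.v *)
From Stdlib Require Import Reals ZArith.
From Coquelicot Require Import Coquelicot.

(** Sequences are 1-indexed, as functions on [nat] of which only the indices
    written below matter: a chain of length [l] has the terms
    [s 1, ..., s (l+1)], and its generators are indexed by [2, ..., l+1]. *)

(** The two earlier terms may coincide (as in [4 = 2 + 2]). *)
Definition addition_chain (l n : nat) (s : nat -> nat) : Prop :=
  (1 <= l)%nat /\ s 1%nat = 1%nat /\ s 2%nat = 2%nat /\ s (l + 1)%nat = n /\
  (forall j : nat, (3 <= j <= l + 1)%nat ->
     exists i i' : nat, (1 <= i < j)%nat /\ (1 <= i' < j)%nat /\
       s j = (s i + s i')%nat).

(** [a i] is the determiner and [r i] the regulator of the [i]-th generator.
    They are integers because the terms are not assumed to be increasing, and
    [r i] is negative when [s i < s (i-1)]. *)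
Definition generators (l : nat) (s : nat -> nat) (a r : nat -> Z) : Prop :=
  a 2%nat = 1%Z /\ r 2%nat = 1%Z /\
  (forall i : nat, (2 <= i <= l + 1)%nat -> Z.of_nat (s i) = (a i + r i)%Z) /\
  (forall i : nat, (2 <= i <= l)%nat -> a (i + 1)%nat = (a i + r i)%Z).

(** The step function [t |-> \sum_(2 <= j <= t) r j]; regulators exist only
    for [j <= l + 1]. *)
Definition regulator_sum (l : nat) (r : nat -> Z) (t : R) : R :=
  sum_n_m (fun j : nat => if Rle_dec (INR j) t then IZR (r j) else 0%R)
    2 (l + 1).

(* Main.v *)
(** Since [a (k+1) = 1 + (r 2 + ... + r k)], the regulator sum is constantly
    [a (k+1) - 1] on [[k, k+1)], so its integral from [1] to [m] is the sum of
    [a j - 1] over [2 <= j <= m]. The integral over [[1, 2]] vanishes because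
    [a 2 = 1], so the integral of the theorem may be started at [1]; this also
    covers [delta = 2], where its bounds are reversed. The remaining terms
    [a delta] and [a (delta+1) = n - r (delta+1)] are explicit. *)
Require Import Defs.
From Stdlib Require Import Reals ZArith Lra Lia.
From Coquelicot Require Import Coquelicot.

Open Scope R_scope.

(** The recurrence for [a] telescopes. The empty sum at [k = 1] is included so that the unit
    interval starting at 1 is covered too. *)
Lemma sum_regulators (l : nat) (s : nat -> nat) (a r : nat -> Z) (k : nat) :
  generators l s a r -> (1 <= k <= l)%nat ->
  sum_n_m (fun j => IZR (r j)) 2 k = IZR (a (k + 1)%nat) - 1.
Proof.
intros (a2 & r2 & _ & Ha).
induction k as [|k IH]; intros Hk; [lia|].
destruct (Nat.eq_dec k 0) as [->|k0].
- rewrite sum_n_m_zero by lia.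
  change (1 + 1)%nat with 2%nat; rewrite a2; change (0 = 1 - 1); lra.
- rewrite sum_n_Sm by lia.
  rewrite IH by lia.
  rewrite (Ha (S k)), plus_IZR by lia.
  replace (k + 1)%nat with (S k) by lia.
  change (IZR (a (S k)) - 1 + IZR (r (S k))
          = IZR (a (S k)) + IZR (r (S k)) - 1); lra.
Qed.

(** The test [INR j <= t] succeeds for [j <= k] and fails for [j >= k + 1 > t], which cuts the sum
    at [k]. *)
Lemma regulator_sum_step (l : nat) (r : nat -> Z) (k : nat) (t : R) :
  (1 <= k <= l)%nat -> INR k <= t < INR k + 1 ->
  regulator_sum l r t = sum_n_m (fun j => IZR (r j)) 2 k.
Proof.
intros Hk Ht; unfold regulator_sum.
rewrite (sum_n_m_Chasles _ 2 k (l + 1)) by lia.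
rewrite (sum_n_m_ext_loc _ (fun j => IZR (r j)) 2 k).
- rewrite (sum_n_m_ext_loc _ (fun _ => zero) (S k) (l + 1)).
  + rewrite sum_n_m_const_zero; apply plus_zero_r.
  + intros j Hj; destruct (Rle_dec (INR j) t) as [H|H]; [|reflexivity].
    assert (INR (S k) <= INR j) by (apply le_INR; lia).
    rewrite S_INR in *; lra.
- intros j Hj; destruct (Rle_dec (INR j) t) as [H|H]; [reflexivity|].
  assert (INR j <= INR k) by (apply le_INR; lia); lra.
Qed.

Lemma is_RInt_regulator_sum (l : nat) (s : nat -> nat) (a r : nat -> Z)
  (m : nat) :
  generators l s a r -> (1 <= m <= l + 1)%nat ->
  is_RInt (regulator_sum l r) 1 (INR m)
    (sum_n_m (fun j => IZR (a j)) 2 m - (INR m - 1)).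
Proof.
intros Hg; induction m as [|m IH]; intros Hm; [lia|].
destruct (Nat.eq_dec m 0) as [->|m0].
- rewrite sum_n_m_zero by lia.
  change (@zero R_AbelianMonoid) with 0; simpl INR.
  replace (0 - (1 - 1)) with 0 by ring.
  exact (is_RInt_point (regulator_sum l r) 1).
- assert (Hstep : is_RInt (regulator_sum l r) (INR m) (INR (S m))
                    (IZR (a (S m)) - 1)).
  (* Agreement on the open interval suffices, so the jump at the right endpoint does no harm. *)
  { apply (is_RInt_ext (fun _ => IZR (a (S m)) - 1)).
    - rewrite S_INR, Rmin_left, Rmax_right by lra; intros t Ht.
      rewrite (regulator_sum_step l r m t) by (lia || lra).
      rewrite (sum_regulators l s a r m) by (assumption || lia).
      now rewrite Nat.add_1_r.
    - set (c := IZR (a (S m)) - 1).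
      assert (Hc := is_RInt_const (INR m) (INR (S m)) c).
      refine (eq_ind _ (is_RInt _ _ _) Hc _ _).
      rewrite S_INR; unfold scal; simpl; unfold mult; simpl; ring. }
  assert (Hsum := is_RInt_Chasles _ _ _ _ _ _ (IH ltac:(lia)) Hstep).
  rewrite sum_n_Sm by lia.
  (* Only the value is expanded; the first occurrence is the endpoint, which has to match [Hsum]. *)
  rewrite (S_INR m) at 2.
  unfold plus in *; simpl in Hsum |- *.
  match type of Hsum with is_RInt _ _ _ ?v =>
    match goal with |- is_RInt _ _ _ ?w => replace w with v by ring end end.
  exact Hsum.
Qed.

Close Scope R_scope.

Theorem theorem2p6 (n delta : nat) (s : nat -> nat) (a r : nat -> Z)
  (hn : (3 <= n)%nat)
  (hs : addition_chain delta n s)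
  (hg : generators delta s a r) :
  (sum_n_m (fun j : nat => IZR (a j)) 2 (delta + 1) =
   (INR n - 1) + (INR delta - 1) + IZR (a delta) - IZR (r (delta + 1)%nat)
   + RInt (regulator_sum delta r) 2 (INR delta - 1))%R.
Proof.
destruct hs as (Hl & _ & s2 & Hn & _).
(* Length 1 would force [n = s 2 = 2]. *)
assert (Hd : (2 <= delta)%nat).
{ destruct (Nat.eq_dec delta 1) as [E|E]; [|lia].
  rewrite E in Hn; simpl in Hn; lia. }
(* Now [delta - 1] is the natural number [S d >= 1], an admissible endpoint for the integral from
   1. *)
destruct delta as [|[|d]]; [lia..|].
assert (H2 := is_RInt_regulator_sum _ _ _ _ 2 hg ltac:(lia)).
assert (H1 := is_RInt_regulator_sum _ _ _ _ (S d) hg ltac:(lia)).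
assert (HI := is_RInt_Chasles _ _ _ _ _ _ (is_RInt_swap _ _ _ _ H2) H1).
apply (is_RInt_unique (V := R_CompleteNormedModule)) in HI.
destruct hg as (a2 & _ & Hs & _).
replace (INR (S (S d)) - 1)%R with (INR (S d)) by (rewrite (S_INR (S d)); ring).
change 2%R with (INR 2); rewrite HI.
assert (Hlast : INR n = (IZR (a (S (S d) + 1)%nat)
                         + IZR (r (S (S d) + 1)%nat))%R).
{ rewrite <- plus_IZR, <- Hs, Hn by lia; apply INR_IZR_INZ. }
rewrite Hlast, sum_n_n, a2.
replace (S (S d) + 1)%nat with (S (S (S d))) by lia.
(* Once the last two determiners are split off, the sum up to [S d] is the one in the integral; it
   is empty for [d = 0]. *)
rewrite (sum_n_Sm _ 2 (S (S d))), (sum_n_Sm _ 2 (S d)) by lia.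
unfold plus, opp; simpl; ring.
Qed.
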